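(* Consider the generic randomised algorithm described in the context, applied to $f:\mathbb{R}^d\to\mathbb{R}$ with $f^*=\min_{x\in\mathbb{R}^d}f(x)$, and suppose that Assumptions (1)–(4) of the context hold with $\delta_S\in(0,1)$, $\alpha_{low}>0$ and $h:\mathbb{R}^2\to\mathbb{R}$. Let $\epsilon>0$, and let $\tau_\alpha\in\mathbb{N}^+$ be such that $\alpha_{min}:=\alpha_0\gamma_1^{\tau_\alpha}$ satisfies $\alpha_{min}\le\alpha_{low}$ and $\alpha_{min}\le\alpha_0/\gamma_2$. Suppose $$\delta_S<\frac{c}{(c+1)^2}.$$ Then for any $\delta_1\in(0,1)$ such that $g(\delta_S,\delta_1)>0$, where $$g(\delta_S,\delta_1)=\left[(1-\delta_S)(1-\delta_1)-1+\frac{c}{(c+1)^2}\right]^{-1},$$ if the algorithm is run for $N$ iterations ($N$ deterministic) with $$N\ge g(\delta_S,\delta_1)\left[\frac{f(x_0)-f^*}{h(\epsilon,\alpha_0\gamma_1^{c+\tau_\alpha})}+\frac{\tau_\alpha}{1+c}\right],$$ we have $$\mathbb{P}\left(N\ge N_\epsilon\right)\ge1-e^{-\frac{\delta_1^2}{2}(1-\delta_S)N}.$$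
   Context: Generic algorithm. Constants: $\gamma_1\in(0,1)$, $\gamma_2=\gamma_1^{-c}$ for some $c\in\mathbb{N}^+$, $\theta\in(0,1)$, $\alpha_{\max}>0$, a deterministic $x_0\in\mathbb{R}^d$, and $\alpha_0=\alpha_{\max}\gamma_1^p$ for some $p\in\mathbb{N}^+$. At iteration $k=0,1,2,\dots$: a (possibly random) reduced model $\hat m_k(\hat s)$, $\hat s\in\mathbb{R}^l$ ($l\le d$), of $f$ around $x_k$ with $\hat m_k(0)=f(x_k)$ is built; a step parameter $\hat s_k=\hat s_k(\alpha_k)$ and a trial step $s_k=w_k(\hat s_k)\in\mathbb{R}^d$ are computed, where $w_k:\mathbb{R}^l\to\mathbb{R}^d$. A sufficient-decrease test (parameterised by $\theta$) comparing $f(x_k+s_k)$ with the model decrease $\hat m_k(0)-\hat m_k(\hat s_k(\alpha_k))$ is performed. If it is passed the iteration is called successful and $x_{k+1}=x_k+s_k$, $\alpha_{k+1}=\min\{\alpha_{\max},\gamma_2\alpha_k\}$; otherwise it is unsuccessful and $x_{k+1}=x_k$, $\alpha_{k+1}=\gamma_1\alpha_k$. All of $x_k,s_k,\alpha_k$ are random variables. $N_\epsilon$ is a random variable defining convergence, which can be a function of $\epsilon$ and of the sequences $\{f(x_k)\},\{\nabla f(x_k)\},\{\nabla^2f(x_k)\}$, for example $N_\epsilon=\min\{k:\|\nabla f(x_k)\|_2\le\epsilon\}$. A certain class of iterations is designated as ''true''; $T_k=1$ if iteration $k$ is true and $T_k=0$ otherwise. Assumptions: (1) There is $\delta_S\in(0,1)$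 such that for any $\bar x_k\in\mathbb{R}^d$ and $k=1,2,\dots$, $\mathbb{P}(T_k=1\mid x_k=\bar x_k)\ge1-\delta_S$; moreover $\mathbb{P}(T_0=1)\ge1-\delta_S$, and $T_k$ is conditionally independent of $T_0,\dots,T_{k-1}$ given $x_k=\bar x_k$. (2) For any $\epsilon>0$ there is an iteration-independent constant $\alpha_{low}>0$ (possibly depending on $\epsilon$ and on problem and algorithm parameters) such that if iteration $k$ is true, $k<N_\epsilon$ and $\alpha_k\le\alpha_{low}$, then iteration $k$ is successful. (3) There is a non-negative function $h(z_1,z_2)$, non-decreasing in its two arguments, with $h(z_1,z_2)>0$ whenever $z_1>0$ and $z_2>0$, such that for any $\epsilon>0$, if iteration $k$ is true and successful with $k<N_\epsilon$, then $f(x_k)-f(x_k+s_k)\ge h(\epsilon,\alpha_k)$. (4) $f(x_k)\ge f(x_{k+1})$ for all $k\in\mathbb{N}$. *)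

(* Defs.v *)
From HB Require Import structures.
From mathcomp Require Import all_boot all_order all_algebra.
From mathcomp Require Import all_classical all_reals all_analysis.
From mathcomp Require Import measurable_realfun.

Set Implicit Arguments.
Unset Strict Implicit.
Unset Printing Implicit Defensive.

Import Order.TTheory GRing.Theory Num.Theory.
Import numFieldNormedType.Exports.

Local Open Scope classical_set_scope.
Local Open Scope ring_scope.

(* R^n is 'rV[R]_n with its Borel sigma-algebra, so that {RV P >-> 'rV[R]_n}
   is the type of R^n-valued random variables. *)
HB.instance Definition _ (R : realType) (m n : nat) :=
  @isMeasurable.Build (sigma_display (@open 'M[R]_(m, n))) 'M[R]_(m, n)
    <<s @open 'M[R]_(m, n) >>
    (@sigma_algebra0 _ setT (@open 'M[R]_(m, n)))
    (@sigma_algebraC _ (@open 'M[R]_(m, n)))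
    (@sigma_algebra_bigcup _ setT (@open 'M[R]_(m, n))).

Section conditioning.
Context {d d' : measure_display} {Om : measurableType d} {E : measurableType d'}
  {R : realType} (P : probability Om R).

(* phi is a version of x |-> P(A | X = x).  Such a function is determined only
   up to a null set of the law of X. *)
Definition is_cond_prob (A : set Om) (X : {RV P >-> E}) (phi : E -> R) : Prop :=
  [/\ measurable_fun [set: E] phi,
      P.-integrable [set: Om] (EFin \o phi \o X) &
      forall B : set E, measurable B ->
        (P (A `&` X @^-1` B) = \int[P]_(w in X @^-1` B) (phi (X w))%:E)%E].

(* P(A `&` B | X) = P(A | X) P(B | X) almost surely, for A in F and B in G. *)
Definition cond_indep (X : {RV P >-> E}) (F G : set (set Om)) : Prop :=
  forall A B : set Om, F A -> G B ->
    exists phiA phiB : E -> R,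
      [/\ is_cond_prob A X phiA, is_cond_prob B X phiB &
          is_cond_prob (A `&` B) X (fun x => phiA x * phiB x)].

Definition sigma_of (Y : {RV P >-> E}) : set (set Om) :=
  preimage_set_system [set: Om] Y measurable.

Definition sigma_before (Y : nat -> {RV P >-> E}) (k : nat) : set (set Om) :=
  <<s \bigcup_(i in [set i | (i < k)%N]) sigma_of (Y i) >>.

End conditioning.

Section algorithm.
Context {d : measure_display} {Om : measurableType d} {R : realType}.

(* The random objects produced by a run.  [step_param k w a] is the step
   parameter \hat s_k as a function of the value a of the parameter alpha_k;
   the models, the step parameters and the prolongations w_k may be random. *)
Record run (P : probability Om R) (n l : nat) := Run {
  iterate : nat -> {RV P >-> 'rV[R]_n} ;
  step : nat -> {RV P >-> 'rV[R]_n} ;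
  alpha : nat -> {RV P >-> R} ;
  model : nat -> Om -> 'rV[R]_l -> R ;
  step_param : nat -> Om -> R -> 'rV[R]_l ;
  prolong : nat -> Om -> 'rV[R]_l -> 'rV[R]_n
}.

Context {P : probability Om R} {n l : nat}.
Implicit Types (f : 'rV[R]_n -> R) (A : run P n l).

(* The sufficient-decrease test is left unspecified: [test theta u v m] tells
   whether it is passed with parameter theta when f(x_k) = u, f(x_k + s_k) = v
   and the model decrease is m. *)
Definition successful f (test : R -> R -> R -> R -> bool) (theta : R) A
    (k : nat) (w : Om) : bool :=
  test theta (f (iterate A k w)) (f (iterate A k w + step A k w))
    (model A k w 0 - model A k w (step_param A k w (alpha A k w))).

Record generic_algorithm f (test : R -> R -> R -> R -> bool)
    (gamma1 gamma2 theta alpha_max alpha0 : R) (x0 : 'rV[R]_n) A : Prop := {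
  iterate0 : forall w, iterate A 0 w = x0 ;
  alpha_init : forall w, alpha A 0 w = alpha0 ;
  model0 : forall k w, model A k w 0 = f (iterate A k w) ;
  stepE : forall k w,
    step A k w = prolong A k w (step_param A k w (alpha A k w)) ;
  update_successful : forall k w, successful f test theta A k w ->
    iterate A k.+1 w = iterate A k w + step A k w /\
    alpha A k.+1 w = Num.min alpha_max (gamma2 * alpha A k w) ;
  update_unsuccessful : forall k w, ~~ successful f test theta A k w ->
    iterate A k.+1 w = iterate A k w /\
    alpha A k.+1 w = gamma1 * alpha A k w
}.

Definition is_min_value f (fstar : R) : Prop :=
  (exists x, f x = fstar) /\ (forall x, fstar <= f x).

(* The conditional bound for every xbar is a statement about some version of
   P(T_k = 1 | x_k = xbar). *)
Definition true_iterations_likely A (T : nat -> {RV P >-> bool}) (deltaS : R)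
    : Prop :=
  [/\ forall k : nat, (0 < k)%N ->
        exists2 phi : 'rV[R]_n -> R,
          is_cond_prob (T k @^-1` [set true]) (iterate A k) phi &
          forall xbar, 1 - deltaS <= phi xbar,
      ((1 - deltaS)%:E <= P (T 0%N @^-1` [set true]))%E &
      forall k : nat, (0 < k)%N ->
        cond_indep (iterate A k) (sigma_of (T k)) (sigma_before T k)].

(* N_eps takes values in the extended reals, +oo meaning that the convergence
   criterion is never met. *)
Definition small_alpha_successful f (test : R -> R -> R -> R -> bool)
    (theta : R) A (T : nat -> {RV P >-> bool}) (Neps : R -> {RV P >-> \bar R})
    (alpha_low : R -> R) : Prop :=
  forall eps : R, 0 < eps ->
    0 < alpha_low eps /\
    forall k w, T k w -> (k%:R%:E < Neps eps w)%E ->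
      alpha A k w <= alpha_low eps -> successful f test theta A k w.

Definition true_successful_decrease f (test : R -> R -> R -> R -> bool)
    (theta : R) A (T : nat -> {RV P >-> bool}) (Neps : R -> {RV P >-> \bar R})
    (h : R -> R -> R) : Prop :=
  [/\ forall z1 z2, 0 <= h z1 z2,
      forall z1 z2 z1' z2', z1 <= z1' -> z2 <= z2' -> h z1 z2 <= h z1' z2',
      forall z1 z2, 0 < z1 -> 0 < z2 -> 0 < h z1 z2 &
      forall eps : R, 0 < eps ->
        forall k w, T k w -> successful f test theta A k w ->
          (k%:R%:E < Neps eps w)%E ->
          h eps (alpha A k w) <=
            f (iterate A k w) - f (iterate A k w + step A k w)].

Definition values_nonincreasing f A : Prop :=
  forall k w, f (iterate A k.+1 w) <= f (iterate A k w).

End algorithm.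

Definition gfun {R : realType} (c : nat) (deltaS delta1 : R) : R :=
  ((1 - deltaS) * (1 - delta1) - 1 + c%:R / c.+1%:R ^+ 2)^-1.

(* Main.v *)
(** Write alpha_k = alpha_max gamma1^(e_k).  A success lowers e_k by c (truncated
    at 0, because of the cap alpha_max) and a failure raises it by 1, while true
    iterations with e_k >= p + tau succeed.  As long as k < N_eps, a true
    success with e_k < p + tau + c decreases f by at least the fixed amount
    h(eps, alpha0 gamma1^(c+tau)); balancing successes against failures bounds
    the other true iterations by (c N + tau) / (c + 1).  Hence on N_eps > N the
    number of true iterations is at most (1 - deltaS) (1 - delta1) N.
    By conditional independence P(T_k = 1 and B) >= (1 - deltaS) P(B) for each B
    in the sigma-algebra of T_0, ..., T_(k-1), so the Chernoff bound for
    independent trials applies; taking the exponential parameter to be delta1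
    already gives the exponent delta1^2 / 2. *)
Require Import Defs.
From HB Require Import structures.
From mathcomp Require Import all_boot all_order all_algebra.
From mathcomp Require Import all_classical all_reals all_analysis.
From mathcomp Require Import measurable_realfun.
From mathcomp Require Import zify ring lra.
Import Order.TTheory GRing.Theory Num.Theory.
Import numFieldNormedType.Exports.
Local Open Scope classical_set_scope.
Local Open Scope ring_scope.

(** * Counting true iterations along one sequence of exponents *)

(* With the potential [phi = minn (e n) M - (e n - M)], every step raises
   [c.+1 * good + c * n + phi] by at least [c.+1] if it is true and by at least
   0 otherwise; [phi] starts at [p] and never exceeds [M]. *)
Lemma true_count_le (c p M N : nat) (e : nat -> nat) (S T : nat -> bool) :
  (0 < c)%N -> (p <= M)%N -> e 0%N = p ->
  (forall k, e k.+1 = if S k then e k - c else (e k).+1)%N ->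
  (forall k, (k < N)%N -> T k -> (M <= e k)%N -> S k) ->
  (c.+1 * \sum_(k < N) T k + p <=
   c.+1 * \sum_(k < N) [&& T k, S k & (e k < M + c)%N] + c * N + M)%N.
Proof.
move=> c0 pM e0 eS TS.
(* The subtracted part of [phi] is put on the left, since subtraction truncates in [nat]. *)
suff H n : (n <= N)%N -> (c.+1 * \sum_(k < n) T k + p + (e n - M) <=
   c.+1 * \sum_(k < n) [&& T k, S k & (e k < M + c)] + c * n + minn (e n) M)%N.
  by have := H N (leqnn N); lia.
elim: n => [_|n IH nN]; first by rewrite !big_ord0; lia.
rewrite !big_ord_recr /= !mulnDr eS.
have {IH} := IH (ltnW nN); have := TS n nN.
move: (\sum_(k < n) _)%N (\sum_(k < n) _)%N => a b.
move: (c.+1 * a)%N (c.+1 * b)%N => {}a {}b.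
(* Both uses of [0 < c]: a success with [e n >= M + c] raises [phi] by [c], and [2 * c >= c.+1]; a
   failure with [e n >= M] lowers [phi] by 1, and cannot be true. *)
case: (T n) => //=; case: (S n) => //= hS; try (case: ltnP => //=); lia.
Qed.

(** * Quadratic bounds on the exponential *)

Lemma expR_ge_quadratic (R : realType) (x : R) : 0 <= x ->
  1 + x + x ^+ 2 / 2 <= expR x.
Proof.
move=> x0; rewrite /expR.
have -> : 1 + x + x ^+ 2 / 2 = series (exp_coeff x) 3.
  rewrite /series /= /exp_coeff unlock /=.
  by rewrite !factS fact0 !muln1; field.
apply: nondecreasing_cvgn_le; last exact: is_cvg_series_exp_coeff.
by apply: nondecreasing_series => n _ _; exact: exp_coeff_ge0.
Qed.

(** The right-hand side times [1 + x + x ^+ 2 / 2] is [1 + x ^+ 4 / 4], hence at least 1. This bound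
    yields the factor 1/2 in the Chernoff exponent. *)
Lemma expRN_le_quadratic (R : realType) (x : R) : 0 <= x ->
  expR (- x) <= 1 - x + x ^+ 2 / 2.
Proof.
move=> x0; rewrite expRN -[_^-1]mul1r ler_pdivrMr ?expR_gt0//.
have q0 : 0 <= 1 - x + x ^+ 2 / 2 by nra.
apply: le_trans (ler_wpM2l q0 (expR_ge_quadratic _ _ x0)).
have -> : (1 - x + x ^+ 2 / 2) * (1 + x + x ^+ 2 / 2) =
  1 + (x ^+ 2 / 2) ^+ 2 by field.
by rewrite lerDl sqr_ge0.
Qed.

(** * Lower bounds on conditional probabilities *)

Section conditional_probability.
Context {d d' : measure_display} {Om : measurableType d}
  {E : measurableType d'} {R : realType} {P : probability Om R}.
Implicit Types (A B : set Om) (X : {RV P >-> E}) (phi : E -> R).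

Lemma measurable_lt_cst phi (a : R) : measurable_fun [set: E] phi ->
  measurable [set x | phi x < a].
Proof.
move=> mphi; have -> : [set x | phi x < a] = [set: E] `&` phi @^-1` `]-oo, a[.
  by apply/seteqP; split => x /=; rewrite in_itv/=; [split|case].
exact: mphi.
Qed.

(** Taking [B] to be the set where [phi < a], the integral of [a - phi] over its preimage is at most
    0 although the integrand is positive there; so the preimage is null. *)
Lemma is_cond_prob_ge A X phi (a : R) : is_cond_prob A X phi ->
  (forall B : set E, measurable B ->
    (a%:E * P (X @^-1` B) <= P (A `&` X @^-1` B))%E) ->
  P (X @^-1` [set x | phi x < a]) = 0.
Proof.
move=> [mphi iphi phiE] ha.
pose V := [set x | phi x < a].
have mV : measurable V by exact: measurable_lt_cst.
pose D := X @^-1` V; have mD : measurable D by exact: measurable_funPTI.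
have iD : P.-integrable D (EFin \o phi \o X).
  exact: integrableS iphi.
have ia : P.-integrable D (EFin \o cst a) by exact: finite_measure_integrable_cst.
pose F w := ((a - phi (X w))%:E)%E.
have FE : F = ((EFin \o cst a) \- (EFin \o phi \o X))%E by [].
have F0 : (\int[P]_(w in D) `|F w| = 0)%E.
  transitivity (\int[P]_(w in D) F w)%E.
    apply: eq_integral => w; rewrite inE => Dw.
    by rewrite gee0_abs// lee_fin subr_ge0 ltW.
  apply/eqP; rewrite eq_le; apply/andP; split; last first.
    by apply: integral_ge0 => w Dw; rewrite lee_fin subr_ge0 ltW.
  rewrite FE integralB_EFin//= integral_cst//.
  rewrite sube_le0; rewrite -phiE//; exact: ha.
have mF : measurable_fun D F.
  rewrite FE; apply: emeasurable_funB; [exact: (measurable_int P)|].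
  exact: (measurable_int P).
have /(ae_eq_integral_abs _ mD mF) := F0.
move=> [Z [mZ PZ0 DZ]].
apply: (subset_measure0 mD mZ _ PZ0) => w Dw; apply: DZ => /= /(_ Dw).
by move=> [] /eqP; rewrite subr_eq0 => /eqP aw; move: Dw; rewrite /D/=/V/= -aw ltxx.
Qed.

(** The version [phi] with the bound need not be the [phiA] given by [cond_indep], but the bound
    passes to [phiA] almost surely, and [phiB >= 0] almost surely. Integrating
    [a * phiB <= phiA * phiB] off the exceptional set concludes. *)
Lemma cond_indep_ge A B X (F G : set (set Om)) phi (a : R) :
  cond_indep X F G -> F A -> G B -> measurable A -> measurable B ->
  is_cond_prob A X phi -> (forall x, a <= phi x) ->
  (a%:E * P B <= P (A `&` B))%E.
Proof.
move=> FG FA GB mA mB [mphi iphi phiE] aphi.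
have [phiA [phiB [cA cB cAB]]] := FG _ _ FA GB.
have A0 : P (X @^-1` [set x | phiA x < a]) = 0.
  apply: (is_cond_prob_ge _ _ _ _ cA) => V mV; rewrite phiE//.
  have mXV : measurable (X @^-1` V) by exact: measurable_funPTI.
  rewrite -integral_cst//; apply: le_integral => //.
  - exact: finite_measure_integrable_cst.
  - exact: integrableS iphi.
  - by move=> w _; rewrite lee_fin.
have B0 : P (X @^-1` [set x | phiB x < 0]) = 0.
  by apply: (is_cond_prob_ge _ _ _ _ cB) => V mV; rewrite mul0e measure_ge0.
case: cA cB cAB => mphA iphA phAE [mphB iphB phBE] [mphAB iphAB phABE].
pose VA := [set x | phiA x < a]; pose VB := [set x | phiB x < 0].
have mVA : measurable VA by exact: measurable_lt_cst.
have mVB : measurable VB by exact: measurable_lt_cst.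
pose V := ~` (VA `|` VB).
have mV : measurable V by apply: measurableC; exact: measurableU.
pose D := X @^-1` V; have mD : measurable D by exact: measurable_funPTI.
have D0 : P (~` D) = 0.
  rewrite /D -preimage_setC setCK preimage_setU.
  by rewrite measureU0//; exact: measurable_funPTI.
have -> : P B = P (B `&` D).
  apply/eqP; rewrite eq_le; apply/andP; split; last first.
    by apply: le_measure; rewrite ?inE//; exact: measurableI.
  rewrite (measureDI P mB mD) [X in (X + _)%E](_ : _ = 0) ?add0e//.
  apply: (subset_measure0 _ _ _ D0); last by move=> w [].
    exact: measurableD.
  exact: measurableC.
apply: (@le_trans _ _ (P (A `&` B `&` D))); last first.
  by apply: le_measure; rewrite ?inE//; [apply: measurableI => //|];
    exact: measurableI.
rewrite phABE// phBE//.
rewrite -integralZl//; last exact: integrableS iphB.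
apply: le_integral => //.
- by apply: integrableZl => //; exact: integrableS iphB.
- exact: integrableS iphAB.
- move=> w; rewrite inE => /not_orP[/negP aw /negP bw]; rewrite -EFinM lee_fin.
  by apply: ler_wpM2r; rewrite leNgt.
Qed.

End conditional_probability.

(** * The number of true iterations and its level sets *)

Section hits.
Context {d : measure_display} {Om : measurableType d}.
Implicit Types T : nat -> Om -> bool.

Definition hits T (k : nat) (w : Om) : nat := (\sum_(i < k) T i w)%N.

Definition hits_level T (k j : nat) : set Om := [set w | hits T k w = j].

Lemma hits_le T k w : (hits T k w <= k)%N.
Proof.
rewrite -[leqRHS]muln1 -[k in leqRHS]card_ord -sum_nat_const.
by apply: leq_sum => i _; case: (T i w).
Qed.

Lemma hitsS T k w : hits T k.+1 w = (hits T k w + T k w)%N.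
Proof. by rewrite /hits big_ord_recr. Qed.

Lemma hits_levelS0 T k :
  hits_level T k.+1 0 = hits_level T k 0 `\` T k @^-1` [set true].
Proof.
rewrite /hits_level; apply/seteqP; split => w /=; rewrite hitsS.
  by case: (T k w); rewrite ?addn0 ?addn1.
by case: (T k w) => -[-> ].
Qed.

Lemma hits_levelSS T k j :
  hits_level T k.+1 j.+1 =
    (hits_level T k j.+1 `\` T k @^-1` [set true]) `|`
    (T k @^-1` [set true] `&` hits_level T k j).
Proof.
rewrite /hits_level; apply/seteqP; split => w /=; rewrite hitsS.
  by case: (T k w); rewrite ?addn0 ?addn1 => H;
    [right; split => //; case: H|left].
by case: (T k w); rewrite ?addn0 ?addn1 => -[[? ?]|[? ?]]//; congr S.
Qed.

(** The space is arbitrary and only [T i] with [i < k] are constrained, so this also applies to the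
    sigma-algebra generated by the past. *)
Lemma measurable_hits_level T k j :
  (forall i, (i < k)%N -> measurable (T i @^-1` [set true])) ->
  measurable (hits_level T k j).
Proof.
elim: k j => [|k IH] j mT.
  rewrite /hits_level; case: j => [|j].
    rewrite [X in measurable X](_ : _ = setT)//.
    by apply/seteqP; split => w //= _; rewrite /hits big_ord0.
  rewrite [X in measurable X](_ : _ = set0)//.
  by apply/seteqP; split => w //=; rewrite /hits big_ord0.
have mk : measurable (T k @^-1` [set true]) by exact: mT.
have {}IH i : measurable (hits_level T k i).
  by apply: IH => m mk'; apply: mT; exact: ltnW.
case: j => [|j].
  by rewrite hits_levelS0; exact: measurableD.
rewrite hits_levelSS; apply: measurableU; first exact: measurableD.
exact: measurableI.
Qed.

End hits.

(** * A Chernoff bound for the lower tail *)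

Section chernoff.
Context {d : measure_display} {Om : measurableType d} {R : realType}
  (P : probability Om R).
Variables (T : nat -> Om -> bool) (a : R).
Hypothesis mT : forall k, measurable (T k @^-1` [set true]).
Hypothesis T_ge : forall k j,
  (a%:E * P (hits_level T k j) <=
   P (T k @^-1` [set true] `&` hits_level T k j))%E.

Let pr A := fine (P A).
Let prE A : measurable A -> P A = (pr A)%:E.
Proof. by move=> mA; rewrite fineK// fin_num_measure. Qed.
Let ml k j : measurable (hits_level T k j).
Proof. exact: measurable_hits_level. Qed.

(** The expectation of [r ^+ hits T k], written as a finite sum over levels. *)
Definition hits_mgf (r : R) k := \sum_(j < k.+1) r ^+ j * pr (hits_level T k j).

Lemma hits_mgfS r k :
  hits_mgf r k.+1 = \sum_(j < k.+1) r ^+ j *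
    (pr (hits_level T k j) -
     (1 - r) * pr (T k @^-1` [set true] `&` hits_level T k j)).
Proof.
rewrite /hits_mgf.
pose b j := pr (T k @^-1` [set true] `&` hits_level T k j).
have mb j : measurable (T k @^-1` [set true] `&` hits_level T k j).
  exact: measurableI.
have prD j : pr (hits_level T k j `\` T k @^-1` [set true]) =
    pr (hits_level T k j) - b j.
  apply: EFin_inj; rewrite EFinB -!prE//; last exact: measurableD.
  rewrite (measureDI P (ml k j) (mT k)) setIC addeK// fin_num_measure//.
have prS0 : pr (hits_level T k.+1 0) = pr (hits_level T k 0) - b 0%N.
  by rewrite hits_levelS0 prD.
have prSS j : pr (hits_level T k.+1 j.+1) =
    pr (hits_level T k j.+1) - b j.+1 + b j.
  rewrite hits_levelSS -prD; apply: EFin_inj.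
  rewrite EFinD -!prE//; [|exact: measurableD|]; last first.
    by apply: measurableU => //; exact: measurableD.
  rewrite measureU//; first exact: measurableD.
  by apply/seteqP; split => w //= [[_ +]] [+ _].
have lk : hits_level T k k.+1 = set0.
  by apply/seteqP; split => w //= Hw; have := hits_le T k w; rewrite Hw ltnn.
rewrite big_ord_recl prS0.
under eq_bigr do rewrite /= prSS mulrDr exprS.
rewrite big_split/= addrA.
have -> : r ^+ 0 * (pr (hits_level T k 0) - b 0%N) +
    \sum_(i < k.+1) r * r ^+ i * (pr (hits_level T k i.+1) - b i.+1) =
    \sum_(i < k.+1) r ^+ i * (pr (hits_level T k i) - b i).
  rewrite big_ord_recr/= [b k.+1]/b !lk setI0 /pr measure0 /= subr0 mulr0 addr0.
  by rewrite [RHS]big_ord_recl; congr (_ + _); apply: eq_bigr => i _; rewrite exprS.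
rewrite -big_split/=; apply: eq_bigr => i _; rewrite -/(b i); ring.
Qed.

(** On each level of the past count, [T k] holds with conditional probability at least [a], so each
    iteration contributes a factor of at most [1 - (1 - r) * a]. *)
Lemma hits_mgf_le r k : 0 <= r <= 1 -> a <= 1 ->
  hits_mgf r k <= (1 - (1 - r) * a) ^+ k.
Proof.
move=> /andP[r0 r1] a1; elim: k => [|k IH].
  rewrite /hits_mgf big_ord1 !expr0 mul1r -lee_fin -prE//.
  exact: probability_le1.
have q0 : 0 <= 1 - (1 - r) * a by nra.
rewrite hits_mgfS exprS; apply: le_trans (ler_wpM2l q0 IH).
rewrite /hits_mgf mulr_sumr; apply: ler_sum => j _.
rewrite mulrCA; apply: ler_wpM2l; first exact: exprn_ge0.
have := T_ge k j; rewrite !prE//; last exact: measurableI.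
rewrite -EFinM lee_fin => H; nra.
Qed.

Lemma measurable_hits_lt k m : measurable [set w | (hits T k w < m)%N].
Proof.
elim: m => [|m IH].
  by rewrite [X in measurable X](_ : _ = set0)//; apply/seteqP; split.
rewrite [X in measurable X](_ : _ =
  [set w | (hits T k w < m)%N] `|` hits_level T k m); first exact: measurableU.
apply/seteqP; split => w /=; rewrite ltnS (leq_eqVlt (hits T k w)).
  by move=> /orP[/eqP|]; [right|left].
by move=> [->|->]; rewrite ?eqxx ?orbT.
Qed.

Lemma hits_lt_sum k m :
  pr [set w | (hits T k w < m)%N] = \sum_(j < m) pr (hits_level T k j).
Proof.
elim: m => [|m IH].
  rewrite big_ord0 [X in pr X](_ : _ = set0) /pr ?measure0//.
  by apply/seteqP; split.
rewrite big_ord_recr -IH; apply: EFin_inj.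
rewrite EFinD -!prE//; try exact: measurable_hits_lt.
rewrite -measureU//; [|exact: measurable_hits_lt|]; last first.
  by apply/seteqP; split => w //=; rewrite /hits_level/= => -[+ eqm];
    rewrite eqm ltnn.
congr (P _); apply/seteqP; split => w /=; rewrite ltnS (leq_eqVlt (hits T k w)).
  by move=> /orP[/eqP|]; [right|left].
by move=> [->|->]; rewrite ?eqxx ?orbT.
Qed.

(* Markov's inequality for [expR (- (delta * hits))]. *)
Lemma hits_chernoff (delta : R) (N m : nat) : 0 <= delta <= 1 -> a <= 1 ->
  0 <= a -> m%:R <= a * (1 - delta) * N%:R ->
  (P [set w | (hits T N w <= m)%N] <=
   (expR (- (delta ^+ 2 / 2 * a * N%:R)))%:E)%E.
Proof.
move=> /andP[d0 d1] a1 a0 mN.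
have mN' : (m.+1 <= N.+1)%N.
  rewrite ltnS -(ler_nat R); apply: le_trans mN _.
  have N0 : 0 <= N%:R :> R by [].
  by rewrite ler_piMl//; nra.
have pr_ge0 X : 0 <= pr X by rewrite fine_ge0// measure_ge0.
pose r := expR (- delta).
have r01 : 0 <= r <= 1 by rewrite expR_ge0 expR_le1 oppr_le0.
rewrite -[X in P X]/[set w | (hits T N w < m.+1)%N] prE; last first.
  exact: measurable_hits_lt.
rewrite lee_fin hits_lt_sum.
(* Levels [j <= m] get weight [expR (delta * (m - j)) >= 1]; the others are nonnegative. *)
apply: (@le_trans _ _ (expR (delta * m%:R) * hits_mgf r N)).
  rewrite /hits_mgf (big_ord_widen _ (fun j => pr (hits_level T N j)) mN').
  rewrite mulr_sumr big_mkcond/=; apply: ler_sum => j _; case: ifP => jm; last first.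
    by rewrite !mulr_ge0 ?expR_ge0// exprn_ge0// expR_ge0.
  rewrite mulrA ler_peMl// -expRM_natr -expRD.
  have -> : delta * m%:R + - delta * j%:R = delta * (m%:R - j%:R) by ring.
  rewrite -[leLHS]expR0 ler_expR; apply: mulr_ge0 => //.
  by rewrite subr_ge0 ler_nat -ltnS.
apply: le_trans (ler_wpM2l (expR_ge0 _) (hits_mgf_le _ N r01 a1)) _.
have q0 : 0 <= 1 - (1 - r) * a by case/andP: r01; nra.
have qe : 1 - (1 - r) * a <= expR (- ((1 - r) * a)) by exact: expR_ge1Dx.
apply: le_trans (ler_wpM2l (expR_ge0 _) (lerXn2r N _ _ qe)) _;
  rewrite ?nnegrE ?expR_ge0//.
rewrite -expRM_natr -expRD ler_expR.
(* The exponent [delta * m - (1 - r) * a * N] is then at most [(delta * (1 - delta) - delta + delta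
   ^+ 2 / 2) * a * N]. *)
have rq : r <= 1 - delta + delta ^+ 2 / 2 by exact: expRN_le_quadratic.
have aN : 0 <= a * N%:R by rewrite mulr_ge0.
have := ler_wpM2l d0 mN; have := ler_wpM2r aN rq.
move: (N%:R : R) (m%:R : R) => x y; nra.
Qed.

End chernoff.

(** * Step sizes and true iterations of a run *)

Fixpoint step_exponent (p c : nat) (S : nat -> bool) (k : nat) : nat :=
  if k is k'.+1 then
    (if S k' then step_exponent p c S k' - c else (step_exponent p c S k').+1)%N
  else p.

Section algorithm_runs.
Context {disp : measure_display} {Om : measurableType disp} {R : realType}
  {P : probability Om R} {d l : nat} {A : run P d l}.

Lemma hits_level_ge (T : nat -> {RV P >-> bool}) (deltaS : R) (k j : nat) :
  true_iterations_likely A T deltaS ->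
  ((1 - deltaS)%:E * P (hits_level T k j) <=
   P (T k @^-1` [set true] `&` hits_level T k j))%E.
Proof.
move=> [hphi h0 hind]; have mT i : measurable (T i @^-1` [set true]).
  exact: measurable_funPTI.
case: k => [|k]; last first.
  have [phi cphi phi_ge] := hphi k.+1 isT.
  apply: (cond_indep_ge _ _ _ _ _ _ _ (hind k.+1 isT)) cphi phi_ge => //.
  - by exists [set true] => //; rewrite setTI.
  (* The level set belongs to [sigma_before]. *)
  - apply: (@measurable_hits_level _
      (g_sigma_algebraType (\bigcup_(i in [set i | (i < k.+1)%N]) sigma_of (T i)))).
    move=> i ik; apply: sub_sigma_algebra; exists i => //.
    by exists [set true] => //; rewrite setTI.
  - by apply: measurable_hits_level => i _; exact: mT.
(* At iteration 0 the level is everything or empty, so the unconditional bound suffices. *)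
case: j => [|j].
  rewrite [hits_level _ _ _](_ : _ = setT); last first.
    by apply/seteqP; split => w //= _; rewrite /hits_level/= /hits big_ord0.
  by rewrite setIT probability_setT mule1.
rewrite [hits_level _ _ _](_ : _ = set0); last first.
  by apply/seteqP; split => w //=; rewrite /hits_level/= /hits big_ord0.
by rewrite setI0 !measure0 mule0.
Qed.

Context {f : 'rV[R]_d -> R} {test : R -> R -> R -> R -> bool}
  {gamma1 gamma2 theta alpha_max alpha0 : R} {c p : nat} {x0 : 'rV[R]_d}.

Lemma alphaE (k : nat) (w : Om) :
  0 < gamma1 < 1 -> gamma2 = gamma1 ^- c -> 0 < alpha_max ->
  alpha0 = alpha_max * gamma1 ^+ p ->
  generic_algorithm f test gamma1 gamma2 theta alpha_max alpha0 x0 A ->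
  alpha A k w = alpha_max *
    gamma1 ^+ step_exponent p c (fun i => successful f test theta A i w) k.
Proof.
move=> /andP[g0 g1] -> amax0 a0E hA.
elim: k => [|k IH]; first by rewrite (alpha_init hA).
rewrite /=; set e := step_exponent _ _ _ _ in IH *; clearbody e.
case: ifPn => hS; last first.
  by have [_ ->] := update_unsuccessful hA hS; rewrite IH exprS mulrCA.
have [_ ->] := update_successful hA hS; rewrite IH.
have gc0 n : 0 < gamma1 ^+ n by rewrite exprn_gt0.
have g1' n : gamma1 ^+ n <= 1 by rewrite exprn_ile1// ltW.
case: (leqP c e) => ce.
  have -> : gamma1 ^- c * (alpha_max * gamma1 ^+ e) = alpha_max * gamma1 ^+ (e - c).
    rewrite mulrCA -{1}(subnK ce) exprD [X in _ * X]mulrC mulfK//.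
    exact: lt0r_neq0.
  by apply: min_r; rewrite ler_piMr// ltW.
(* When [e < c] the cap is active, matching the truncation of [e - c] to 0. *)
have -> : gamma1 ^- c * (alpha_max * gamma1 ^+ e) = alpha_max / gamma1 ^+ (c - e).
  rewrite mulrCA -{1}(subnK (ltnW ce)) exprD invfM -mulrA mulVf ?mulr1//.
  exact: lt0r_neq0.
have -> : (e - c)%N = 0%N by apply/eqP; rewrite subn_eq0 ltnW.
rewrite expr0 mulr1; apply: min_l.
by rewrite ler_peMr ?invr_ge1 ?unitf_gt0// ltW.
Qed.

Lemma true_hits_le {fstar : R} {T : nat -> {RV P >-> bool}}
    {Neps : R -> {RV P >-> \bar R}} {alpha_low : R -> R} {h : R -> R -> R}
    {eps : R} {tau N : nat} {w : Om} :
  is_min_value f fstar ->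
  0 < gamma1 < 1 -> (0 < c)%N -> gamma2 = gamma1 ^- c ->
  0 < alpha_max -> alpha0 = alpha_max * gamma1 ^+ p ->
  generic_algorithm f test gamma1 gamma2 theta alpha_max alpha0 x0 A ->
  small_alpha_successful f test theta A T Neps alpha_low ->
  true_successful_decrease f test theta A T Neps h ->
  values_nonincreasing f A ->
  0 < eps -> alpha0 * gamma1 ^+ tau <= alpha_low eps ->
  (N%:R%:E < Neps eps w)%E ->
  (hits T N w)%:R <=
    (f x0 - fstar) / h eps (alpha0 * gamma1 ^+ (c + tau))
    + tau%:R / (1 + c)%:R + c%:R / c.+1%:R * N%:R.
Proof.
move=> [_ fmin] hg c0 g2 am0 a0E hA hlow [_ hmono hpos hdec] hmon eps0 tlow hNw.
have /andP[g0 g1] := hg.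
set hs := h eps _.
have a0 : 0 < alpha0 by rewrite a0E mulr_gt0// exprn_gt0.
have hs0 : 0 < hs by apply: hpos => //; rewrite mulr_gt0// exprn_gt0.
pose S k := successful f test theta A k w.
pose e := step_exponent p c S.
have aE k : alpha A k w = alpha_max * gamma1 ^+ e k by exact: alphaE.
have kN k : (k < N)%N -> (k%:R%:E < Neps eps w)%E.
  by move=> kN; apply: lt_trans hNw; rewrite lte_fin ltr_nat.
(* The bound on [e k] gives [alpha0 * gamma1 ^+ (c + tau) <= alpha_k], so a good iteration decreases
   [f] by at least [hs]. *)
pose good k := [&& T k w, S k & (e k < p + tau + c)%N].
have TS k : (k < N)%N -> T k w -> (p + tau <= e k)%N -> S k.
  move=> /kN kNe Tk ek; apply: (hlow _ eps0).2 => //.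
  apply: le_trans tlow; rewrite aE a0E -mulrA -exprD (ler_wpM2l (ltW am0))//.
  exact: (ler_wiXn2l (ltW g0) (ltW g1)).
(* With [M = p + tau], the initial exponent [p] cancels and leaves [tau]. *)
have := @true_count_le c p (p + tau) N e S (fun k => T k w) c0
  (leq_addr _ _) erefl (fun k => erefl) TS.
rewrite -/(hits T N w) -/good => hcount.
have good_sum n : (n <= N)%N ->
    (\sum_(k < n) good k)%:R * hs <= f x0 - f (iterate A n w).
  elim: n => [_|n IH nN]; first by rewrite big_ord0 mul0r (iterate0 hA) subrr.
  rewrite big_ord_recr/= natrD mulrDl.
  have := IH (ltnW nN); have := hmon n w.
  case: (boolP (good n)) => [/and3P[Tn Sn en]|_]; last by rewrite mul0r; lra.
  have := hdec _ eps0 n w Tn Sn (kN _ nN).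
  have [-> _] := update_successful hA Sn.
  have : hs <= h eps (alpha A n w).
    apply: hmono => //; rewrite aE a0E -mulrA -exprD (ler_wpM2l (ltW am0))//.
    by apply: (ler_wiXn2l (ltW g0) (ltW g1)); lia.
  by rewrite mul1r; lra.
have G : (\sum_(k < N) good k)%:R <= (f x0 - fstar) / hs.
  rewrite ler_pdivlMr//; apply: le_trans (good_sum N (leqnn N)) _.
  by rewrite lerD2l lerN2.
have c1 : 0 < c.+1%:R :> R by rewrite ltr0n.
rewrite -(ler_pM2l c1) add1n.
move: hcount; rewrite -(ler_nat R) !natrD !natrM => hcount.
have : c.+1%:R * (\sum_(k < N) good k)%:R <= c.+1%:R * ((f x0 - fstar) / hs).
  by rewrite ler_pM2l.
have -> : c.+1%:R * ((f x0 - fstar) / hs + tau%:R / c.+1%:R + c%:R / c.+1%:R * N%:R) =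
  c.+1%:R * ((f x0 - fstar) / hs) + tau%:R + c%:R * N%:R.
  by rewrite !mulrDr; congr (_ + _ + _); field; exact: lt0r_neq0.
lra.
Qed.

End algorithm_runs.

(** * From the count on each run to the probability bound *)

Theorem theorem4p2p1 (disp : measure_display) (Om : measurableType disp)
  (R : realType) (P : probability Om R) (d l : nat) (f : 'rV[R]_d -> R)
  (fstar : R)
  (test : R -> R -> R -> R -> bool)
  (gamma1 gamma2 theta alpha_max alpha0 : R) (c p : nat) (x0 : 'rV[R]_d)
  (A : run P d l)
  (T : nat -> {RV P >-> bool}) (Neps : R -> {RV P >-> \bar R})
  (deltaS : R) (alpha_low : R -> R) (h : R -> R -> R)
  (eps : R) (tau : nat) (delta1 : R) (N : nat)
  (hld : (l <= d)%N) (hfstar : is_min_value f fstar)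
  (hgamma1 : 0 < gamma1 < 1) (hc : (0 < c)%N) (hgamma2 : gamma2 = gamma1 ^- c)
  (htheta : 0 < theta < 1) (halpha_max : 0 < alpha_max)
  (hp : (0 < p)%N) (halpha0 : alpha0 = alpha_max * gamma1 ^+ p)
  (hA : generic_algorithm f test gamma1 gamma2 theta alpha_max alpha0 x0 A)
  (hdeltaS : 0 < deltaS < 1)
  (h1 : true_iterations_likely A T deltaS)
  (h2 : small_alpha_successful f test theta A T Neps alpha_low)
  (h3 : true_successful_decrease f test theta A T Neps h)
  (h4 : values_nonincreasing f A)
  (heps : 0 < eps) (htau : (0 < tau)%N)
  (htau_low : alpha0 * gamma1 ^+ tau <= alpha_low eps)
  (htau_gamma2 : alpha0 * gamma1 ^+ tau <= alpha0 / gamma2)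
  (hdeltaSc : deltaS < c%:R / c.+1%:R ^+ 2)
  (hdelta1 : 0 < delta1 < 1) (hg : 0 < gfun c deltaS delta1)
  (hN : gfun c deltaS delta1 *
          ((f x0 - fstar) / h eps (alpha0 * gamma1 ^+ (c + tau))
           + tau%:R / (1 + c)%:R) <= N%:R) :
  ((1 - expR (- (delta1 ^+ 2 / 2 * (1 - deltaS) * N%:R)))%:E
     <= P [set w | (Neps eps w <= N%:R%:E)%E])%E.
Proof.
have /andP[dS0 dS1] := hdeltaS; have /andP[d0 d1] := hdelta1.
set x : R := (1 - deltaS) * (1 - delta1) * N%:R.
have x0_ge0 : 0 <= x by rewrite !mulr_ge0// subr_ge0 ltW.
(* The count is an integer, so being at most [x] is being at most its floor. *)
set m := Num.truncn x.
have mx : m%:R <= x by rewrite truncn_le.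
have hitsm w : (N%:R%:E < Neps eps w)%E -> (hits T N w <= m)%N.
  move=> Nw; rewrite truncn_ge_nat//.
  apply: le_trans (true_hits_le hfstar hgamma1 hc hgamma2 halpha_max
    halpha0 hA h2 h3 h4 heps htau_low Nw) _.
  move: hg hN; rewrite /gfun invr_gt0 => D0; rewrite ler_pdivrMl// => B.
  apply: le_trans (lerD B (lexx _)) _.
  rewrite -mulrDl /x ler_wpM2r//.
  have c1 : 0 < c.+1%:R :> R by rewrite ltr0n.
  rewrite -!addrA gerDl addrC subr_le0.
  (* The sum is [1 - 1 / c.+1 ^+ 2], so it is at most the 1 subtracted in [gfun]. *)
  have -> : c%:R / c.+1%:R ^+ 2 + c%:R / c.+1%:R =
    (c%:R + c%:R * c.+1%:R) / c.+1%:R ^+ 2 :> R by field; exact: lt0r_neq0.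
  rewrite ler_pdivrMr ?exprn_gt0// -natr1.
  by have : 0 <= c%:R :> R by []; nra.
have mNeps : measurable [set w | (Neps eps w <= N%:R%:E)%E].
  have -> : [set w | (Neps eps w <= N%:R%:E)%E] =
      Neps eps @^-1` [set` `]-oo, N%:R%:E]%E%O].
    by apply/seteqP; split => w; rewrite /= in_itv.
  by apply: measurable_funPTI; exact: emeasurable_itv.
have := probability_setC P (measurableC mNeps).
rewrite setCK => ->; rewrite EFinB; apply: leeB => //.
have mT k : measurable (T k @^-1` [set true]) by exact: measurable_funPTI.
apply: (@le_trans _ _ (P [set w | (hits T N w <= m)%N])); last first.
  apply: (hits_chernoff P T (1 - deltaS)) => //.
  - by move=> k j; exact: hits_level_ge h1.
  - by rewrite (ltW d0) ltW.
  - by rewrite gerBl ltW.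
  - by rewrite subr_ge0 ltW.
apply: le_measure; rewrite ?inE; first exact: measurableC.
  exact: (measurable_hits_lt _ mT N m.+1).
by move=> w /= /negP; rewrite -ltNge; exact: hitsm.
Qed.
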